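(* Let $q>1$. For every real $t>0$, \[\int_0^1\log\Gamma_q(x+t)\,dx=\log C_q-\frac{1}{2q^t\log q}\left[\frac{1-q^t}{1-q^{-t}}\left(2\,\mathrm{Li}_2(q^{-t})+\log^2(1-q^{-t})\right)+2\,\frac{1-q^t}{1-q^{-t}}\log\frac{1-q}{1-q^t}\,\log(1-q^{-t})-q^t\log^2\frac{1-q}{1-q^t}\right].\] In particular (the case $t=0$), \[\int_0^1\log\Gamma_q(x)\,dx=\frac{\zeta(2)}{\log q}+\log\sqrt{\frac{q-1}{\sqrt[6]{q}}}+\log(q^{-1};q^{-1})_\infty.\] Here $\Gamma_q$ is Jackson's $q$-gamma function for $q>1$, $C_q=q^{-\frac1{12}}(q-1)^{\frac12-\frac{\log(q-1)}{2\log q}}(q^{-1};q^{-1})_\infty$, $\mathrm{Li}_2$ is the dilogarithm and $\zeta$ is the Riemann zeta function.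
   Context: For $|p|<1$, $(a;p)_\infty=\prod_{k=0}^\infty(1-ap^k)$. For $q>1$ and real $z>0$, Jackson's $q$-gamma function is \[\Gamma_q(z)=\frac{(q^{-1};q^{-1})_\infty}{(q^{-z};q^{-1})_\infty}(q-1)^{1-z}q^{z(z-1)/2}.\] The dilogarithm is $\mathrm{Li}_2(z)=\sum_{n=1}^\infty\frac{z^n}{n^2}$ for $|z|\le 1$. All logarithms are real logarithms of positive numbers, and $\log^2 u$ means $(\log u)^2$. *)

(* Defs.v *)
From HB Require Import structures.
From mathcomp Require Import all_boot all_order all_algebra.
From mathcomp Require Import all_classical all_reals all_analysis.

Set Implicit Arguments.
Unset Strict Implicit.
Unset Printing Implicit Defensive.

Import Order.TTheory GRing.Theory Num.Theory.
Import numFieldNormedType.Exports.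

Local Open Scope classical_set_scope.
Local Open Scope ring_scope.

(* [limn] is total, so the three limits below carry their usual meaning only
   where they converge: [`|p| < 1], [`|z| <= 1] and [1 < s] respectively. *)
Definition qpoch (R : realType) (a p : R) : R :=
  limn (fun n : nat => \prod_(0 <= k < n) (1 - a * p ^+ k)).

Definition dilog (R : realType) (z : R) : R :=
  limn (fun n : nat => \sum_(1 <= k < n.+1) z ^+ k / k%:R ^+ 2).

Definition zeta (R : realType) (s : R) : R :=
  limn (fun n : nat => \sum_(1 <= k < n.+1) (k%:R `^ s)^-1).

(* Jackson's q-gamma function in the range [1 < q], for [0 < z].  At [z = 0]
   the denominator vanishes, and the value is [0] since [0^-1 = 0]. *)
Definition qGamma (R : realType) (q z : R) : R :=
  qpoch q^-1 q^-1 / qpoch (q `^ (- z)) q^-1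
  * (q - 1) `^ (1 - z) * q `^ (z * (z - 1) / 2).

Definition Cq (R : realType) (q : R) : R :=
  q `^ (- (1 / 12)) * (q - 1) `^ (1 / 2 - ln (q - 1) / (2 * ln q))
  * qpoch q^-1 q^-1.

(* Main.v *)
(** With [L = ln q] and [p = q^-1], [ln (qGamma q z)] equals
    [- ln (p^z; p)_oo] plus a quadratic polynomial in [z].  Expanding the
    logarithms of the factors gives the nonnegative double series
    [- ln (p^z; p)_oo = \sum_k \sum_n p^((n+1)(z+k)) / (n+1)].  Integrating it
    termwise over [z] in [t, t+1] and exchanging the sums, the sum over [k] is
    geometric with ratio [p^(n+1)] and cancels the factor [1 - p^(n+1)] produced
    by the integration; what remains is [Li_2(p^t) / L].  The bracket of the
    statement is [- q^t (2 Li_2(q^-t) + (ln (q - 1) - t L)^2)], a square having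
    been completed.  Everything is valid at [t = 0] on the half-open interval. *)
Require Import Defs.
From HB Require Import structures.
From mathcomp Require Import all_boot all_order all_algebra.
From mathcomp Require Import all_classical all_reals all_analysis.
From mathcomp Require Import ring lra measurable_realfun.

Set Implicit Arguments.
Unset Strict Implicit.
Unset Printing Implicit Defensive.

Import Order.TTheory GRing.Theory Num.Theory.
Import numFieldNormedType.Exports.

Local Open Scope classical_set_scope.
Local Open Scope ring_scope.

(** * Series for the logarithm, the q-Pochhammer symbol and the dilogarithm *)

Lemma eseries_EFin_lim (R : realType) (u : nat -> R) (l : R) :
  series u @ \oo --> l -> (\sum_(n <oo) (u n)%:E)%E = l%:E.
Proof.
move=> ul; apply/cvg_lim => //.
under eq_fun do rewrite sumEFin.
exact: (cvg_comp _ _ ul).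
Qed.

(** Differentiating the Taylor remainder termwise leaves the tail of the geometric series for
    [1 / (1 - x)]. *)
Lemma is_derive_ln_series_rem (R : realType) (N : nat) (x : R) : x < 1 ->
  is_derive x 1 (fun u : R => - ln (1 - u) - \sum_(k < N) u ^+ k.+1 / k.+1%:R)
    (x ^+ N / (1 - x)).
Proof.
move=> x1; elim: N => [|N IH].
  have -> : (fun u : R => - ln (1 - u) - \sum_(k < 0) u ^+ k.+1 / k.+1%:R) =
            (fun u => - ln (1 - u)).
    by apply/funext => u; rewrite big_ord0 subr0.
  have h : 0 < 1 - x by rewrite subr_gt0.
  have D := is_derive1_ln h.
  apply: is_derive_eq.
  by rewrite expr0 /=; field; rewrite gt_eqF.
have -> : (fun u : R => - ln (1 - u) - \sum_(k < N.+1) u ^+ k.+1 / k.+1%:R) =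
          (fun u => (- ln (1 - u) - \sum_(k < N) u ^+ k.+1 / k.+1%:R)
                    - N.+1%:R^-1 *: (u ^+ N.+1)).
  by apply/funext => u; rewrite big_ord_recr /= opprD addrA [_ *: _]mulrC.
have D : is_derive x 1 (fun u : R => N.+1%:R^-1 *: u ^+ N.+1) (x ^+ N).
  rewrite (_ : (fun u : R => _) = N.+1%:R^-1 *: ((@id R) ^+ N.+1)); last first.
    by apply/funext => u; rewrite !fctE.
  apply: is_derive_eq.
  by rewrite /GRing.scale /= mulr1 mulrA mulVf ?mul1r// pnatr_eq0.
apply: is_derive_eq (is_deriveB IH D) _.
by rewrite exprSr; field; rewrite subr_eq0 gt_eqF.
Qed.

Lemma cvg_series_ln (R : realType) (x : R) : 0 <= x < 1 ->
  series (fun k : nat => x ^+ k.+1 / k.+1%:R) @ \oo --> - ln (1 - x).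
Proof.
move=> /andP[x0 x1].
(* The mean value theorem on [[0, x]] gives the remainder as [c ^+ N / (1 - c) * x] with [c <= x],
   hence the bound [x ^+ N.+1 / (1 - x)]. *)
have rem N : `|- ln (1 - x) - series (fun k : nat => x ^+ k.+1 / k.+1%:R) N|
             <= geometric (x / (1 - x)) x N.
  have [c c0x] : exists2 c, c \in `[0, x] &
     (- ln (1 - x) - \sum_(k < N) x ^+ k.+1 / k.+1%:R)
     - (- ln (1 - 0) - \sum_(k < N) 0 ^+ k.+1 / k.+1%:R)
     = (c ^+ N / (1 - c)) * (x - 0).
    apply: (@MVT_segment _ (fun u : R => - ln (1 - u)
        - \sum_(k < N) u ^+ k.+1 / k.+1%:R) (fun c => c ^+ N / (1 - c))) => //.
      move=> u; rewrite in_itv /= => /andP[_ ux].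
      exact/is_derive_ln_series_rem/(lt_trans ux).
    apply: derivable_within_continuous => u; rewrite in_itv /= => /andP[_ ux].
    exact/ex_derive/is_derive_ln_series_rem/(le_lt_trans ux).
  move: c0x; rewrite in_itv /= => /andP[c0 cx].
  rewrite [X in _ - (_ - X)]big1; last by move=> k _; rewrite exprS !mul0r.
  rewrite !subr0 ln1 oppr0 subr0 => eq.
  rewrite /series /= big_mkord eq ger0_norm; last first.
    by rewrite !mulr_ge0 ?exprn_ge0 ?invr_ge0 ?subr_ge0 // ltW// (le_lt_trans cx).
  rewrite [leRHS](_ : _ = x ^+ N / (1 - x) * x); last by rewrite /=; ring.
  have c1 : c < 1 by exact: le_lt_trans x1.
  rewrite ler_wpM2r// ler_pM ?exprn_ge0 ?invr_ge0 ?subr_ge0 ?(ltW c1)//.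
    exact: lerXn2r.
  by rewrite lef_pV2 ?posrE ?subr_gt0// lerB.
apply/cvgrPdist_le => e e0; near=> N.
apply: le_trans (rem N) _.
rewrite -[leLHS]ger0_norm; last first.
  by rewrite /= mulr_ge0 ?divr_ge0 ?exprn_ge0// subr_ge0 ltW.
near: N; apply: cvgr0_norm_le => //.
by apply: cvg_geometric; rewrite ger0_norm.
Unshelve. all: by end_near. Qed.

Lemma nneseries_ln (R : realType) (x : R) : 0 <= x < 1 ->
  (\sum_(k <oo) (x ^+ k.+1 / k.+1%:R)%:E)%E = (- ln (1 - x))%:E.
Proof. by move=> /cvg_series_ln /eseries_EFin_lim. Qed.

(** The partial products are exponentials of minus the partial sums. Once the series of logarithms
    converges, the infinite product is the exponential of a real number, hence positive. *)
Lemma qpoch_gt0_cvg_series_ln (R : realType) (a p : R) :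
  0 <= a < 1 -> 0 <= p < 1 -> 0 < qpoch a p /\
  series (fun k : nat => - ln (1 - a * p ^+ k)) @ \oo --> - ln (qpoch a p).
Proof.
move=> /andP[a0 a1] /andP[p0 p1].
have apk0 k : 0 <= a * p ^+ k by rewrite mulr_ge0 ?exprn_ge0.
have apka k : a * p ^+ k <= a by rewrite ler_piMr// exprn_ile1// ltW.
have apk1 k : a * p ^+ k < 1 by exact: le_lt_trans a1.
have s0 k : 0 <= - ln (1 - a * p ^+ k).
  by rewrite oppr_ge0 ln_le0// gerBl.
(* With [u = a * p ^+ k], [- ln (1 - u) = ln (1 + u / (1 - u)) <= u / (1 - u)], and [1 - u >= 1 - a]
   makes the bound geometric in [k]. *)
have ub k : - ln (1 - a * p ^+ k) <= geometric (a / (1 - a)) p k.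
  rewrite -lnV ?posrE ?subr_gt0//.
  have -> : (1 - a * p ^+ k)^-1 = 1 + a * p ^+ k / (1 - a * p ^+ k).
    by field; rewrite gt_eqF// subr_gt0.
  apply: (@le_trans _ _ (a * p ^+ k / (1 - a * p ^+ k))).
    apply: le_ln1Dx; apply: (@lt_le_trans _ _ 0) => //.
    by rewrite divr_ge0// subr_ge0 ltW.
  rewrite [leRHS](_ : _ = a * p ^+ k / (1 - a)); last by rewrite /=; ring.
  by rewrite ler_wpM2l// lef_pV2 ?posrE ?subr_gt0// lerB.
have cv : cvgn (series (fun k : nat => - ln (1 - a * p ^+ k))).
  apply: (series_le_cvg s0 _ ub).
    by move=> k; exact: le_trans (ub k).
  by apply: is_cvg_geometric_series; rewrite ger0_norm.
suff -> : qpoch a p = expR (- limn (series (fun k : nat => - ln (1 - a * p ^+ k)))).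
  by rewrite expRK opprK expR_gt0.
apply/cvg_lim => //.
have -> : (fun n => \prod_(0 <= k < n) (1 - a * p ^+ k)) =
  expR \o (fun n => - series (fun k : nat => - ln (1 - a * p ^+ k)) n).
  apply/funext => n /=; rewrite /series /= -sumrN expR_sum.
  by apply: eq_bigr => k _; rewrite opprK lnK// posrE subr_gt0.
apply: continuous_cvg; first exact: continuous_expR.
exact: cvgN.
Qed.

Lemma nneseries_ln_qpoch (R : realType) (a p : R) : 0 <= a < 1 -> 0 <= p < 1 ->
  (\sum_(k <oo) (- ln (1 - a * p ^+ k))%:E)%E = (- ln (qpoch a p))%:E.
Proof. by move=> a01 /(qpoch_gt0_cvg_series_ln a01)[_ /eseries_EFin_lim]. Qed.

(** The terms are nonnegative, so bounded partial sums suffice. The endpoint [z = 1] is included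
    because the case [t = 0] needs it. *)
Lemma cvg_dilog (R : realType) (z : R) : 0 <= z <= 1 ->
  series (fun n : nat => z ^+ n.+1 / n.+1%:R ^+ 2) @ \oo --> dilog z.
Proof.
move=> /andP[z0 z1].
have seriesE : (fun n : nat => \sum_(1 <= k < n.+1) z ^+ k / k%:R ^+ 2) =
     series (fun n : nat => z ^+ n.+1 / n.+1%:R ^+ 2).
  by apply/funext => n; rewrite /series /= big_add1.
rewrite /dilog seriesE.
have u0 k : 0 <= z ^+ k.+1 / k.+1%:R ^+ 2 by rewrite divr_ge0 ?exprn_ge0.
apply: nondecreasing_is_cvgn.
  by apply: nondecreasing_series => k _ _.
exists 2 => _ [n _ <-].
have zk k : z ^+ k.+1 / k.+1%:R ^+ 2 <= k.+1%:R ^- 2.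
  by rewrite -[leRHS]mul1r ler_wpM2r ?invr_ge0 ?exprn_ge0 ?exprn_ile1.
case: n => [|n]; first by rewrite /series /= big_nil.
(* The sharper bound makes the induction close: [1 / (n+2)^2 <= 1 / (n+1) - 1 / (n+2)]
   telescopes. *)
suff : series (fun k : nat => z ^+ k.+1 / k.+1%:R ^+ 2) n.+1 <= 2 - n.+1%:R^-1.
  by move=> /le_trans; apply; rewrite gerBl.
elim: n => [|n IH].
  rewrite /series /= big_nat1 (le_trans (zk 0%N))// expr1n invr1; lra.
rewrite /series /= big_nat_recr//=.
suff h : z ^+ n.+2 / n.+2%:R ^+ 2 <= n.+1%:R^-1 - n.+2%:R^-1.
  by apply: le_trans (lerD IH h) _; rewrite addrA subrK.
apply: (le_trans (zk n.+1)).
have -> : n.+1%:R^-1 - n.+2%:R^-1 = (n.+1%:R * n.+2%:R)^-1 :> R.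
  rewrite -[n.+2%:R]natr1; have : 0 < n.+1%:R :> R by rewrite ltr0n.
  move: n.+1%:R => m m0; field.
  by rewrite !gt_eqF// addr_gt0.
rewrite lef_pV2 ?posrE ?mulr_gt0 ?exprn_gt0// expr2 ler_wpM2r// ler_nat//.
Qed.

Lemma zeta2 (R : realType) : zeta (2 : R) = dilog 1.
Proof.
rewrite /zeta /dilog; congr (limn _); apply/funext => n.
by apply: eq_bigr => k _; rewrite expr1n div1r powR_mulrn.
Qed.

(** * Elementary integrals over the half-open unit interval *)

Section integral_oc01.
Context {R : realType} (F f : R -> R).
Hypothesis dF : forall x : R, is_derive x 1 F (f x).
Hypothesis cf : continuous f.

Lemma integrable_oc01 :
  lebesgue_measure.-integrable `]0, 1] (EFin \o f).
Proof.
have : lebesgue_measure.-integrable `[0, 1] (EFin \o f).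
  apply: continuous_compact_integrable; first exact: segment_compact.
  exact: continuous_subspaceT.
by apply: integrableS => //; apply: subset_itvr; rewrite bnd_simp.
Qed.

Lemma integral_oc01_FTC2 :
  (\int[lebesgue_measure]_(x in `]0%R, 1%R]) (f x)%:E = (F 1 - F 0)%:E)%E.
Proof.
have cF x : {for x, continuous F}.
  by apply/differentiable_continuous/derivable1_diffP/ex_derive.
rewrite integral_itv_obnd_cbnd; last first.
  exact: measurable_int integrable_oc01.
rewrite (@continuous_FTC2 _ f F)//.
- exact: continuous_subspaceT.
- split.
  + by move=> x _; case: (dF x).
  + by apply: cvg_at_right_filter; apply: cF.
  + by apply: cvg_at_left_filter; apply: cF.
- by move=> x _; rewrite derive1E; case: (dF x).
Qed.

End integral_oc01.

Lemma integral_expR_linear (R : realType) (c s m : R) : 0 < c -> m != 0 ->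
  (\int[lebesgue_measure]_(x in `]0%R, 1%R]) (expR (- c * (x + s)) / m)%:E
  = (expR (- c * s) * (1 - expR (- c)) / (c * m))%:E)%E.
Proof.
move=> c0 m0.
have D (x : R) : is_derive x 1 (fun x : R => - (c * m)^-1 * expR (- c * (x + s)))
    (expR (- c * (x + s)) / m).
  apply: is_derive_eq; rewrite /GRing.scale /=.
  by field; rewrite m0 gt_eqF.
have C : continuous (fun x : R => expR (- c * (x + s)) / m).
  move=> x; apply: (@cvgMr_tmp _ _ _ _ (fun x : R => expR (- c * (x + s)))).
  apply: continuous_comp; last exact: continuous_expR.
  by apply: cvgMl_tmp; apply: cvgD; [exact: cvg_id|exact: cvg_cst].
rewrite (integral_oc01_FTC2 D C) add0r mulrDr mulr1 expRD; congr EFin; ring.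
Qed.

Lemma integral_quadratic (R : realType) (a b c : R) :
  (\int[lebesgue_measure]_(x in `]0%R, 1%R]) (a * (x * x) + b * x + c)%:E
  = (a / 3 + b / 2 + c)%:E)%E /\
  lebesgue_measure.-integrable `]0, 1] (fun x : R => (a * (x * x) + b * x + c)%:E).
Proof.
have D (x : R) : is_derive x 1
    (fun x => a / 3 * (x * (x * x)) + b / 2 * (x * x) + c * x) (a * (x * x) + b * x + c).
  apply: is_derive_eq; rewrite /GRing.scale /=.
  by field.
have C : continuous (fun x : R => a * (x * x) + b * x + c).
  move=> x; apply: cvgD; last exact: cvg_cst.
  apply: cvgD; apply: cvgMl_tmp; last exact: cvg_id.
  by apply: cvgM; exact: cvg_id.
split; last exact: integrable_oc01 C.
by rewrite (integral_oc01_FTC2 D C); congr EFin; ring.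
Qed.

(** * Termwise integration of the logarithm of the q-Pochhammer symbol *)

Section integral_ln_qpoch.
Context {R : realType} (q t : R).
Hypotheses (q1 : 1 < q) (t0 : 0 <= t).

Let L_gt0 : 0 < ln q. Proof. exact: ln_gt0. Qed.
Let q0 : 0 < q. Proof. exact: lt_trans q1. Qed.
Let p01 : 0 <= q^-1 < 1.
Proof. by rewrite invr_ge0 ltW//= invf_lt1. Qed.

Lemma powRN_itv01 (s : R) : 0 < s -> 0 <= q `^ (- s) < 1.
Proof.
move=> s0; rewrite powR_ge0 /= /powR gt_eqF// expR_lt1.
by rewrite mulNr oppr_lt0 mulr_gt0.
Qed.

(** General term of the double series at [z = x + t], in exponential form so that its antiderivative
    in [x] is immediate; [hE] recovers the power form. *)
Let h (k n : nat) (x : R) : R :=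
  expR (- (n.+1%:R * ln q) * (x + (t + k%:R))) / n.+1%:R.

Let hE k n x : h k n x = (q `^ (- (x + t)) * q^-1 ^+ k) ^+ n.+1 / n.+1%:R.
Proof.
rewrite /h; congr (_ / _).
rewrite -[q^-1 ^+ k]powR_mulrn ?invr_ge0 ?ltW// -powR_inv1 ?ltW// -powRrM.
rewrite -powRD ?(gt_eqF q0) ?implybT//.
rewrite -powR_mulrn ?powR_ge0// -powRrM.
by rewrite /powR gt_eqF//; congr expR; ring.
Qed.

Let h_ge0 k n x : 0 <= h k n x. Proof. by rewrite divr_ge0 ?expR_ge0. Qed.

Let measurable_h k n (D : set R) : measurable_fun D ((fun x => (h k n x)%:E) : R -> \bar R).
Proof.
apply/measurable_EFinP/measurable_funTS/measurable_funM => //.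
apply: measurableT_comp => //; apply: measurable_funM => //.
exact: measurable_funD.
Qed.

Let ln_qpochE (x : R) : 0 < x ->
  (\sum_(k <oo) \sum_(n <oo) (h k n x)%:E)%E
  = (- ln (qpoch (q `^ (- (x + t))) q^-1))%:E.
Proof.
(* Since [x > 0], the exponent [x + t] is positive even for [t = 0], so the base stays below 1. *)
move=> x0; have /andP[a0 a1] := powRN_itv01 (ltr_pwDl x0 t0).
have /andP[p0 p1] := p01.
rewrite -nneseries_ln_qpoch ?a0//; apply: eq_eseriesr => k _.
under eq_eseriesr do rewrite hE.
rewrite nneseries_ln// mulr_ge0 ?exprn_ge0//= (le_lt_trans _ a1)//.
by rewrite ler_piMr// exprn_ile1// ltW.
Qed.

(** Measurability is inherited from the double series of nonnegative measurable terms, which agrees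
    with the function on the interval. *)
Let measurable_ln_qpoch : measurable_fun `]0, (1 : R)]
  ((fun x => (- ln (qpoch (q `^ (- (x + t))) q^-1))%:E) : R -> \bar R).
Proof.
apply: (@eq_measurable_fun _ _ _ _ _
    (fun x => \sum_(k <oo) \sum_(n <oo) (h k n x)%:E)%E).
  by move=> x; rewrite inE /= in_itv /= => /andP[x0 _]; rewrite ln_qpochE.
apply: ge0_emeasurable_sum => [k x _ _|k _].
  by apply: nneseries_ge0 => n _ _; rewrite lee_fin.
by apply: ge0_emeasurable_sum => [n x _ _|n _]; rewrite ?lee_fin.
Qed.

Let integral_h k n :
  (\int[lebesgue_measure]_(x in `]0%R, 1%R]) (h k n x)%:E =
   (geometric ((q `^ (- t)) ^+ n.+1 * (1 - q^-1 ^+ n.+1) / (n.+1%:R ^+ 2 * ln q))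
      (q^-1 ^+ n.+1) k)%:E)%E.
Proof.
rewrite /h integral_expR_linear ?mulr_gt0 ?pnatr_eq0//; congr EFin.
have -> : expR (- (n.+1%:R * ln q)) = q^-1 ^+ n.+1.
  by rewrite -mulrN expRM_natl -lnV ?posrE// lnK// posrE invr_gt0.
have -> : expR (- (n.+1%:R * ln q) * (t + k%:R))
         = (q `^ (- t)) ^+ n.+1 * (q^-1 ^+ n.+1) ^+ k.
  (* The exponential is read off from [hE] at [x = 0] after cancelling the common factor
     [1 / (n+1)]. *)
  have := hE k n 0; rewrite /h add0r => /(mulIf _) ->.
    by rewrite exprMn -!exprM mulnC add0r.
  by rewrite invr_eq0 pnatr_eq0.
rewrite /geometric /=; move: (q^-1 ^+ n.+1) => w; field.
by rewrite gt_eqF//= pnatr_eq0.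
Qed.

Lemma integral_ln_qpoch :
  (\int[lebesgue_measure]_(x in `]0%R, 1%R])
     (- ln (qpoch (q `^ (- (x + t))) q^-1))%:E
   = (dilog (q `^ (- t)) / ln q)%:E)%E.
Proof.
have /andP[p0 p1] := p01.
under eq_integral => x.
  rewrite inE /= in_itv /= => /andP[x0 _].
  rewrite -ln_qpochE//.
  over.
rewrite integral_nneseries//; last 2 first.
- move=> k; apply: ge0_emeasurable_sum => [n x _ _|n _]; rewrite ?lee_fin//.
  exact: measurable_h.
- by move=> k x _; apply: nneseries_ge0 => n _ _; rewrite lee_fin.
under eq_eseriesr => k _.
  rewrite integral_nneseries//; last 2 first.
  - by move=> n; exact: measurable_h.
  - by move=> n x _; rewrite lee_fin.
  over.
(* After the exchange the inner sum runs over [k] and is geometric with ratio [q^-1 ^+ n.+1]. *)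
rewrite nneseries_interchange; last first.
  by move=> k n; apply: integral_ge0 => x _; rewrite lee_fin.
have w1 n : q^-1 ^+ n.+1 < 1 by rewrite exprn_ilt1.
have normw1 n : `|q^-1 ^+ n.+1| < 1 by rewrite ger0_norm ?exprn_ge0.
under eq_eseriesr => n _.
  under eq_eseriesr do rewrite integral_h.
  rewrite (eseries_EFin_lim (cvg_geometric_series (normw1 n))).
  over.
apply: eseries_EFin_lim.
have -> : series (fun n : nat => (q `^ (- t)) ^+ n.+1 * (1 - q^-1 ^+ n.+1)
                / (n.+1%:R ^+ 2 * ln q) / (1 - q^-1 ^+ n.+1)) =
  (fun n => series (fun n : nat => (q `^ (- t)) ^+ n.+1 / n.+1%:R ^+ 2) n
            / ln q).
  apply/funext => n; rewrite /series /= mulr_suml; apply: eq_bigr => k _.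
  field.
  by rewrite gt_eqF//= nat1r pnatr_eq0/= subr_eq0 gt_eqF.
(* Only [q ^ (-t) <= 1] is required here, with equality at [t = 0]. *)
apply: cvgMr_tmp; apply: cvg_dilog; rewrite powR_ge0 /=.
by rewrite /powR (gt_eqF q0) -expR0 ler_expR mulNr oppr_le0 mulr_ge0// ltW.
Qed.

(** The function is nonnegative on the interval, so its absolute value has the finite integral just
    computed. *)
Lemma integrable_ln_qpoch : lebesgue_measure.-integrable `]0, 1]
  (fun x => (- ln (qpoch (q `^ (- (x + t))) q^-1))%:E).
Proof.
apply/integrableP; split; first exact: measurable_ln_qpoch.
under eq_integral => x.
  rewrite inE /= in_itv /= => /andP[x0 _].
  rewrite ger0_norm; last first.
    rewrite -lee_fin -ln_qpochE//; apply: nneseries_ge0 => k _ _.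
    by apply: nneseries_ge0 => n _ _; rewrite lee_fin.
  over.
by rewrite integral_ln_qpoch ltry.
Qed.

End integral_ln_qpoch.

(** * The integral of the logarithm of the q-gamma function *)

Lemma ln_qGamma (R : realType) (q z : R) : 1 < q -> 0 < z ->
  ln (qGamma q z) = - ln (qpoch (q `^ (- z)) q^-1) +
    (ln (qpoch q^-1 q^-1) + (1 - z) * ln (q - 1) + z * (z - 1) / 2 * ln q).
Proof.
move=> q1 z0; have q0 : 0 < q by exact: lt_trans q1.
have p01 : 0 <= q^-1 < 1 by rewrite invr_ge0 ltW//= invf_lt1.
have [P0 _] := qpoch_gt0_cvg_series_ln p01 p01.
have [A0 _] := qpoch_gt0_cvg_series_ln (powRN_itv01 q1 z0) p01.
have q10 : 0 < q - 1 by rewrite subr_gt0.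
rewrite /qGamma !lnM ?posrE ?mulr_gt0 ?invr_gt0 ?powR_gt0// lnV// !ln_powR.
ring.
Qed.

Lemma integral_ln_qGamma (R : realType) (q t : R) : 1 < q -> 0 <= t ->
  lebesgue_measure.-integrable `]0, 1]
    (fun x : R => (ln (qGamma q (x + t)))%:E) /\
  \int[lebesgue_measure]_(x in `]0, 1]) ln (qGamma q (x + t)) =
    dilog (q `^ (- t)) / ln q + ln (qpoch q^-1 q^-1)
    + (1 / 2 - t) * ln (q - 1) + (t ^+ 2 / 2 - 1 / 12) * ln q.
Proof.
move=> q1 t0.
set L := ln q; set M := ln (q - 1); set P := ln (qpoch q^-1 q^-1).
(* Coefficients in [x] of [P + (1 - z) * M + z * (z - 1) / 2 * L] at [z = x + t]. *)
pose a := L / 2; pose b := (t - 1 / 2) * L - M.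
pose c := P + (1 - t) * M + t * (t - 1) / 2 * L.
have fE : {in `]0, 1]%classic, forall x : R,
    (- ln (qpoch (q `^ (- (x + t))) q^-1) + (a * (x * x) + b * x + c)) =
    ln (qGamma q (x + t))}.
  move=> x; rewrite inE /= in_itv /= => /andP[x0 _].
  rewrite ln_qGamma ?ltr_pwDl//; congr (_ + _).
  by rewrite /a /b /c -/L -/M -/P; field.
have I1 := integrable_ln_qpoch q1 t0.
have [E2 I2] := integral_quadratic a b c.
split.
  apply: eq_integrable (integrableD _ I1 I2) => //.
  by move=> x xI /=; rewrite -fE.
rewrite -(eq_Rintegral lebesgue_measure fE) RintegralD// /Rintegral integral_ln_qpoch// E2 /=.
by rewrite /a /b /c -/L; field; rewrite gt_eqF// ln_gt0.
Qed.

Theorem theorem1 (R : realType) (q : R) (hq : 1 < q) :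
  (forall t : R, 0 < t ->
    lebesgue_measure.-integrable `[0, 1]
      (fun x : R => (ln (qGamma q (x + t)))%:E) /\
    \int[lebesgue_measure]_(x in `[0, 1]) ln (qGamma q (x + t)) =
      ln (Cq q) - 1 / (2 * q `^ t * ln q) *
        ((1 - q `^ t) / (1 - q `^ (- t))
           * (2 * dilog (q `^ (- t)) + ln (1 - q `^ (- t)) ^+ 2)
         + 2 * ((1 - q `^ t) / (1 - q `^ (- t)))
           * ln ((1 - q) / (1 - q `^ t)) * ln (1 - q `^ (- t))
         - q `^ t * ln ((1 - q) / (1 - q `^ t)) ^+ 2)) /\
  (lebesgue_measure.-integrable `]0, 1]
     (fun x : R => (ln (qGamma q x))%:E) /\
   \int[lebesgue_measure]_(x in `]0, 1]) ln (qGamma q x) =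
     zeta 2 / ln q + ln (Num.sqrt ((q - 1) / q `^ (1 / 6)))
     + ln (qpoch q^-1 q^-1)).
Proof.
have q0 : 0 < q by exact: lt_trans hq.
have L0 : 0 < ln q by exact: ln_gt0.
have q10 : 0 < q - 1 by rewrite subr_gt0.
have p01 : 0 <= q^-1 < 1 by rewrite invr_ge0 ltW//= invf_lt1.
have [P0 _] := qpoch_gt0_cvg_series_ln p01 p01.
split=> [t t0|].
  have [I E] := integral_ln_qGamma hq (ltW t0).
  (* Adding the endpoint 0, a null set, changes neither measurability nor the integral of the
     absolute value. *)
  have I' : lebesgue_measure.-integrable `[0, 1]
      (fun x : R => (ln (qGamma q (x + t)))%:E).
    have /integrableP[mf foo] := I.
    have mf' : measurable_fun `[(0 : R), 1]
        ((fun x => (ln (qGamma q (x + t)))%:E) : R -> \bar R).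
      exact/emeasurable_fun_itv_obnd_cbndP.
    apply/integrableP; split => //.
    rewrite -integral_itv_obnd_cbnd//.
    exact: measurableT_comp.
  split => //; rewrite -Rintegral_itv_obnd_cbnd// E.
  have /andP[_ z1] := powRN_itv01 hq t0.
  have qt : q `^ t = (q `^ (- t))^-1 by rewrite powRN invrK.
  have z0 : 0 < q `^ (- t) by exact: powR_gt0.
  have nz0 : q `^ (- t) != 0 by rewrite gt_eqF.
  have nz1 : 1 - q `^ (- t) != 0 by rewrite subr_eq0 gt_eqF.
  have lnz : ln (q `^ (- t)) = - t * ln q by rewrite ln_powR.
  (* Numerator and denominator are both negative; this form has positive factors only, so its
     logarithm splits. *)
  have -> : (1 - q) / (1 - q `^ t) = (q - 1) * q `^ (- t) / (1 - q `^ (- t)).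
    by rewrite qt; field; rewrite nz1 nz0 -opprB oppr_eq0.
  rewrite ln_div ?posrE ?mulr_gt0 ?subr_gt0// lnM ?posrE// lnz.
  rewrite /Cq !lnM ?posrE ?mulr_gt0 ?powR_gt0// !ln_powR qt.
  (* Since [(1 - q^t) / (1 - q^(-t)) = - q^t], all occurrences of [ln (1 - q^(-t))] cancel. The
     remaining square contributes [(ln (q - 1) - t * ln q)^2 / (2 * ln q)], whose [ln (q - 1)^2]
     part cancels the one in [ln (Cq q)]. *)
  by field; rewrite nz0 nz1 gt_eqF.
have [I E] := integral_ln_qGamma hq (lexx 0).
rewrite oppr0 powRr0 -zeta2 in E.
have fE : (fun x : R => ln (qGamma q (x + 0))) = (fun x => ln (qGamma q x)).
  by apply/funext => x; rewrite addr0.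
rewrite fE in E; have {}I : lebesgue_measure.-integrable `]0, 1]
    (fun x : R => (ln (qGamma q x))%:E).
  by apply: eq_integrable I => // x _; rewrite addr0.
split => //; rewrite E.
(* The square root halves both logarithms, and half of [1 / 6] gives the coefficient [- 1 / 12] of
   [ln q]. *)
rewrite -powR12_sqrt ?divr_ge0 ?powR_ge0 ?(ltW q10)// ln_powR ln_div ?posrE ?powR_gt0//.
rewrite ln_powR; field.
by rewrite gt_eqF.
Qed.
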